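(* Let $X$ be a proper metric space and let $\bar X$ be a compactification of $X$. The following statements are equivalent: (i) the compactification $\bar X$ is coarse; (ii) the relation $r_{\bar X}$ on subsets of $X$ is a large-scale proximity relation; (iii) every function in $C_{\bar X}(X)$ is Higson. Moreover, if $r$ is any large-scale proximity relation on $X$, then the compactification $\bar X^r$ is coarse. If $\mathcal A$ is an algebra of bounded continuous functions on $X$ all of whose elements are Higson, then the compactification $\bar X^{\mathcal A}$ generated by $\mathcal A$ is coarse.
   Context: A metric space is proper if every bounded subset has compact closure. A compactification of $X$ is a compact Hausdorff space $\bar X$ with an open embedding $X\to\bar X$ with dense image; $X$ is identified with its image, and $\partial X:=\bar X\setminus X$ is the boundary. An entourage of a metric space $(X,d)$ is a subset $E\subseteq X\times X$ with $\sup_{(x,y)\in E}d(x,y)<\infty$. For $E\subseteq X\times X$, $T\subseteq X$ put $E[T]=\{x:\exists y\in T,(x,y)\in E\}$. The compactification $\bar X$ is coarse if for every two nets $(x_i)_i,(y_i)_i$ in $X$ (same index set) such that $\{(x_i,y_i)\}_i$ is an entourage, both nets have the same limit (cluster) points on the boundary $\partial X$. For $A,B\subseteq X$: $A\, r_{\bar X}\, B$ iff $(\bar A\cap\partial X)\cap(\bar B\cap\partial X)\neq\emptyset$ (closures in $\bar X$). Large-scale proximity relation: a relation $r$ on subsets of $X$ (with $A\,\bar r\,B$ meaning not $A\,r\,B$) such that (1) for $B\subseteq X$: $B\,\bar r\, B$ iff $B$ is bounded; (2) $A\,r\,B$ implies $B\,r\,A$; (3) if $A,A'\subseteq X$ and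 $E$ is an entourage with $A'\subseteq E[A]$, $A\subseteq E[A']$, then $A\,r\,B$ implies $A'\,r\,B$ for every $B\subseteq X$; (4) $(A\cup B)\,r\,C$ iff ($A\,r\,C$ or $B\,r\,C$); (5) if $A\,\bar r\,B$ then there are $C,D\subseteq X$ with $C\cup D=X$, $C\,\bar r\,A$, $D\,\bar r\,B$. A bounded continuous $\varphi:X\to\mathbb R$ is Higson if for every entourage $E$ the map $E\to\mathbb R$, $(x,y)\mapsto\varphi(x)-\varphi(y)$, vanishes at infinity (for every $\varepsilon>0$ there is a bounded $K\subseteq X$ with $|\varphi(x)-\varphi(y)|<\varepsilon$ for $(x,y)\in E\setminus (K\times K)$). $C_{\bar X}(X)$ is the algebra of bounded continuous real functions on $X$ that extend continuously to $\bar X$. For a set $\mathcal A$ of bounded continuous functions on $X$, $\bar X^{\mathcal A}$ is the smallest compactification of $X$ to which all functions in $\mathcal A$ extend continuously. The compactification $\bar X^r$: a Delone subset of $X$ is a subset $S$ such that for some $R>0$, $d(s,t)\ge R$ for all distinct $s,t\in S$, and $E[S]=X$ for some entourage $E$. Let $S\subseteq X$ be Delone, $\hat S$ the set of nonprincipal ultrafilters on $S$, and $\sigma\lambda_r\tau$ iff $A\,r\,B$ for all $A\in\sigma$, $B\in\tau$ (an equivalence relation). Put $\partial_rX=\hat S/\lambda_r$ (independent of $S$ up to homeomorphism). For $A\subseteq X$ let $\mathrm{cl}(A)=\{[\sigma]\in\partial_rX: A\,r\,B\text{ for all }B\in\sigma\}$. Then $\bar X^r=X\sqcup\partial_rX$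 with closed sets generated by the sets $\bar A\cup\mathrm{cl}(A)$, $A\subseteq X$, where $\bar A$ is the closure of $A$ in $X$. *)

(* Defs.v *)
From HB Require Import structures.
From mathcomp Require Import all_boot all_order all_algebra.
From mathcomp Require Import all_classical all_reals all_analysis.

Set Implicit Arguments.
Unset Strict Implicit.
Unset Printing Implicit Defensive.

Import Order.TTheory GRing.Theory Num.Theory.
Import numFieldNormedType.Exports.

Local Open Scope classical_set_scope.
Local Open Scope ring_scope.

Section MetricNotions.
Context {R : realType} {X : metricType R}.
Implicit Types (A B C D S T K : set X) (E : set (X * X)) (f : X -> R).

Definition metric_bounded B : Prop :=
  exists M : R, forall x y, B x -> B y -> mdist x y <= M.

(* These are the entourages of the bounded coarse structure, as opposed to
   those of the metric uniformity, which the library calls [entourage]. *)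
Definition coarse_entourage E : Prop :=
  exists M : R, forall x y, E (x, y) -> mdist x y <= M.

Definition thicken E T : set X := [set x | exists2 y, T y & E (x, y)].

Definition delone S : Prop :=
  (exists2 r : R, 0 < r & forall s t, S s -> S t -> s <> t -> r <= mdist s t) /\
  (exists2 E, coarse_entourage E & thicken E S = setT).

Definition higson f : Prop :=
  [/\ bounded_fun f, continuous f &
      forall E, coarse_entourage E -> forall e : R, 0 < e ->
        exists2 K, metric_bounded K &
          forall x y, E (x, y) -> ~ (K x /\ K y) -> `|f x - f y| < e].

Record large_scale_proximity (r : set X -> set X -> Prop) : Prop := {
  lsp_bounded : forall B, ~ r B B <-> metric_bounded B ;
  lsp_sym : forall A B, r A B -> r B A ;
  lsp_coarse : forall A A' E, coarse_entourage E ->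
    A' `<=` thicken E A -> A `<=` thicken E A' ->
    forall B, r A B -> r A' B ;
  lsp_union : forall A B C, r (A `|` B) C <-> r A C \/ r B C ;
  lsp_split : forall A B, ~ r A B ->
    exists C D, [/\ C `|` D = setT, ~ r C A & ~ r D B]
}.

(* Closed under the operations of a real algebra; a unit is not required. *)
Definition function_algebra (F : set (X -> R)) : Prop :=
  [/\ F (cst 0),
      forall f g, F f -> F g -> F (f \+ g),
      forall f g, F f -> F g -> F (f \* g) &
      forall (a : R) f, F f -> F (a \*: f)].

End MetricNotions.

Definition proper_metric {R : realType} (X : metricType R) : Prop :=
  forall B : set X, metric_bounded B -> compact (closure B).

Section Compactifications.
Context {R : realType} {X : metricType R}.

Definition compactification {Y : topologicalType} (i : X -> Y) : Prop :=
  [/\ compact [set: Y] /\ hausdorff_space Y,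
      injective i,
      continuous i,
      forall U : set X, open U -> open (i @` U) &
      dense (range i)].

Definition boundary {Y : topologicalType} (i : X -> Y) : set Y := ~` range i.

(* The filter generated by the tails of a net. *)
Definition net_filter {I : Type} (le : I -> I -> Prop) {Y : Type} (u : I -> Y) :
    set_system Y :=
  [set U | exists k0, forall k, le k0 k -> U (u k)].

Definition directed {I : Type} (le : I -> I -> Prop) : Prop :=
  [/\ inhabited I,
      forall k, le k k,
      forall k l m, le k l -> le l m -> le k m &
      forall k l, exists2 m, le k m & le l m].

Definition coarse_compactification {Y : topologicalType} (i : X -> Y) : Prop :=
  forall (I : Type) (le : I -> I -> Prop), directed le ->
  forall x y : I -> X, coarse_entourage (range (fun k => (x k, y k))) ->
    cluster (net_filter le (i \o x)) `&` boundary i =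
    cluster (net_filter le (i \o y)) `&` boundary i.

Definition boundary_rel {Y : topologicalType} (i : X -> Y) (A B : set X) : Prop :=
  (closure (i @` A) `&` boundary i) `&` (closure (i @` B) `&` boundary i) !=set0.

Definition extends {Y : topologicalType} (i : X -> Y) (f : X -> R) : Prop :=
  exists2 g : Y -> R, continuous g & g \o i = f.

Definition extendable {Y : topologicalType} (i : X -> Y) : set (X -> R) :=
  [set f | [/\ bounded_fun f, continuous f & extends i f]].

(* The order on compactifications: Y is at most Z when the identity of X
   extends to a continuous map from Z to Y. *)
Definition generated_compactification (F : set (X -> R))
    {Y : topologicalType} (i : X -> Y) : Prop :=
  [/\ compactification i,
      forall f, F f -> extends i f &
      forall (Z : topologicalType) (j : X -> Z), compactification j ->
        (forall f, F f -> extends j f) ->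
        exists2 h : Z -> Y, continuous h & h \o j = i].

End Compactifications.

Section ProximityCompactification.
Context {R : realType} {X : metricType R}.
Variables (r : set X -> set X -> Prop) (S : set X).

Definition nonprincipal_ultrafilter : Type :=
  {s : set_system S | UltraFilter s /\ forall x : S, s <> principal_filter x}.

Implicit Types s t : nonprincipal_ultrafilter.

Definition ultra_rel s t : Prop :=
  forall A B : set S, sval s A -> sval t B -> r (set_val @` A) (set_val @` B).

Definition ultra_class s : set nonprincipal_ultrafilter := [set t | ultra_rel s t].

(* The quotient by [ultra_rel], which is an equivalence relation when r is a
   large-scale proximity relation and S is Delone. *)
Definition prox_boundary : Type := {c | range ultra_class c}.

Definition prox_space : Type := (X + prox_boundary)%type.

Definition prox_embed : X -> prox_space := inl.

Definition prox_cl (A : set X) : set prox_boundary :=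
  [set c | exists2 s, sval c = ultra_class s &
           forall B : set S, sval s B -> r A (set_val @` B)].

Definition prox_closed (A : set X) : set prox_space :=
  (inl @` closure A) `|` (inr @` prox_cl A).

HB.instance Definition _ := gen_eqMixin prox_space.
HB.instance Definition _ := gen_choiceMixin prox_space.
(* The coarsest topology in which every [prox_closed A] is closed. *)
HB.instance Definition _ := @isSubBaseTopological.Build prox_space
  (set X) setT (fun A => ~` prox_closed A).

End ProximityCompactification.

(* Main.v *)
Require Import Defs.
From mathcomp Require Import all_boot all_order all_algebra.
From mathcomp Require Import all_classical all_reals all_analysis.
From mathcomp Require Import finmap ring lra.

Set Implicit Arguments.
Unset Strict Implicit.
Unset Printing Implicit Defensive.

Import Order.TTheory GRing.Theory Num.Theory.
Import numFieldNormedType.Exports.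

Local Open Scope classical_set_scope.
Local Open Scope ring_scope.

(** A compactification is coarse when its boundary does not distinguish points
    that stay at bounded distance from each other.  The three conditions say
    this with nets, with subsets and with functions.  Properness of [X]
    makes bounded sets the same as sets without limit points on the boundary
    ([metric_boundedP]), so that going to infinity in the sense of the metric
    and approaching the boundary are the same thing.

    From nets to subsets: a boundary point in the closure of a set is the limit
    of a net in that set, and coarseness moves the net to any other set at
    bounded distance ([coarse_closure_transfer]); the splitting axiom is the
    normality of compact Hausdorff spaces.  From subsets to functions: if an
    extendable function kept oscillating along pairs of nearby points going to
    infinity, these pairs would accumulate at some pair [(p, q)] by compactness
    of the square; the first coordinates close to [p] and the second
    coordinates close to [q] form two sets at bounded distance, while the
    function keeps their limit points apart ([proximity_higson]).  From
    functions to nets: along indices for which the first net approaches [p],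
    let the second one accumulate at [q]; the extension of a Higson function
    has the same value at [p] and [q], so [p = q] as soon as these extensions
    separate points ([separation_coarse]), and Urysohn functions do.

    For a large-scale proximity relation [r], the trace of the closure of [A]
    on the boundary is [prox_cl A], which only depends on [A] up to bounded
    distance.  This gives coarseness ([prox_coarse]).  Compactness comes from
    Zorn: an ultrafilter on [prox_space r S] that is not carried by a bounded
    set selects, among the subsets of [S], those whose thickening it charges,
    and some ultrafilter on [S] consists of selected sets only; its class is
    the limit ([prox_compact]).

    For a family [F] of Higson functions, adjoin to [F] the bump functions of
    all balls.  They are Higson and extend by zero to every compactification,
    so they do not change the generated compactification, and the enlarged
    family embeds [X] homeomorphically in a product of bounded intervals.  The
    closure of the image is the smallest compactification ([hull_generated]).
    Its coordinates separate points, hence so do those of any compactification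
    generated by [F] ([generated_separated]), and the criterion
    [separation_coarse] applies. *)

(** * Bounded sets in a metric space *)

Section BoundedSets.
Context {R : realType} {X : metricType R}.
Implicit Types (B : set X) (x y : X) (M e : R).

Definition dist_entourage M : set (X * X) := [set p | mdist p.1 p.2 <= M].

Lemma coarse_dist_entourage M : coarse_entourage (dist_entourage M).
Proof. by exists M. Qed.

Lemma metric_bounded_of_center B x M :
  (forall y, B y -> mdist x y <= M) -> metric_bounded B.
Proof.
move=> h; exists (M + M) => y z By Bz.
by rewrite (le_trans (metric_triangle y x z))// lerD ?h// metric_sym h.
Qed.

Lemma metric_bounded_ball x e : metric_bounded (ball x e).
Proof.
by apply: (@metric_bounded_of_center _ x e) => y; rewrite ballEmdist => /ltW.
Qed.

Lemma metric_bounded_thicken M B :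
  metric_bounded B -> metric_bounded (thicken (dist_entourage M) B).
Proof.
move=> [N hN]; exists (M + (N + M)) => x y [x' Bx' xx'] [y' By' yy'].
apply: (le_trans (metric_triangle x x' y)); apply: lerD => //.
apply: (le_trans (metric_triangle x' y' y)); apply: lerD; first exact: hN.
by rewrite metric_sym.
Qed.

Lemma mdist_continuous x : continuous (fun y => mdist x y : R).
Proof.
move=> y; apply/cvgrPdist_le => e e0; near=> z.
have yz : mdist y z <= e.
  suff: ball y e z by rewrite ballEmdist => /ltW.
  by near: z; exact: nbhsx_ballx.
have := metric_triangle x y z; have := metric_triangle x z y.
rewrite (metric_sym z y) ler_distl => h1 h2.
rewrite lerBlDr (le_trans h2) ?lerD2l//=.
by rewrite -lerBlDr in h1; rewrite -lerBlDr (le_trans _ h1)// lerB.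
Unshelve. all: by end_near. Qed.

End BoundedSets.

(** * Boundary points and the three forms of coarseness *)

(** Exchanging the two nets turns an entourage into its inverse, which is an
    entourage, so that one inclusion is enough. *)
Lemma coarse_compactification_sub {R : realType} {X : metricType R}
    {Y : topologicalType} (i : X -> Y) :
  (forall (I : Type) (le : I -> I -> Prop), directed le ->
    forall x y : I -> X, coarse_entourage (range (fun k => (x k, y k))) ->
    cluster (net_filter le (i \o x)) `&` boundary i `<=`
    cluster (net_filter le (i \o y))) ->
  coarse_compactification i.
Proof.
move=> sub I le dI x y xy; apply/seteqP; split=> p [px bp]; split=> //.
  exact: (sub _ _ dI _ _ xy p (conj px bp)).
have yx : coarse_entourage (range (fun k => (y k, x k))).
  have [M hM] := xy; exists M => _ _ [k _ [<- <-]].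
  by rewrite metric_sym; apply: hM; exists k.
exact: (sub _ _ dI _ _ yx p (conj px bp)).
Qed.

Section Boundary.
Context {R : realType} {X : metricType R} {Y : topologicalType} {i : X -> Y}.
Hypothesis X_proper : proper_metric X.
Hypothesis ci : compactification i.
Implicit Types (A B K : set X).

Let ci_compact : compact [set: Y]. Proof. by have [[]] := ci. Qed.
Let ci_hausdorff : hausdorff_space Y. Proof. by have [[]] := ci. Qed.
Let ci_inj : injective i. Proof. by have [_ ? _ _ _] := ci. Qed.
Let ci_continuous : continuous i. Proof. by have [_ _ ? _ _] := ci. Qed.
Let ci_open U : open U -> open (i @` U).
Proof. by have [_ _ _ + _] := ci; exact. Qed.

Lemma open_range_embed : open (range i).
Proof. by apply: ci_open; exact: openT. Qed.

Lemma closed_boundary : closed (boundary i).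
Proof. exact/open_closedC/open_range_embed. Qed.

Lemma closed_image_bounded K : metric_bounded K -> closed (i @` closure K).
Proof.
move=> /X_proper Kc; apply: compact_closed => //.
by apply: continuous_compact Kc; exact/continuous_subspaceT.
Qed.

Lemma closure_image_bounded K :
  metric_bounded K -> closure (i @` K) `<=` i @` closure K.
Proof.
move=> Kb; rewrite [X in _ `<=` X](closure_id _).1; last first.
  exact: closed_image_bounded.
by apply: closureS; apply: image_subset; exact: subset_closure.
Qed.

Lemma nbhs_boundary_bounded p K : boundary i p -> metric_bounded K ->
  nbhs p (~` (i @` K)).
Proof.
move=> bp Kb; apply: (@filterS _ _ _ (~` (i @` closure K))).
  by apply/subsetC; apply: image_subset; exact: subset_closure.
apply: open_nbhs_nbhs; split; first exact/closed_openC/closed_image_bounded.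
by apply: contra_not bp => -[x _ <-]; exists x.
Qed.

(** If the closure of [B] in [Y] lies in [X], then it is a compact set covered
    by the increasing family of balls around a point, one of which contains
    it. *)
Lemma metric_boundedP B :
  metric_bounded B <-> closure (i @` B) `&` boundary i = set0.
Proof.
split=> [Bb|B0].
  rewrite -subset0 => p [/(closure_image_bounded Bb)[x _ <-]].
  by apply; exists x.
have cB : compact (closure (i @` B)).
  by apply: (subclosed_compact _ ci_compact) => //; exact: closed_closure.
have sB : closure (i @` B) `<=` range i.
  move=> p cp; apply: contrapT => bp.
  by have : set0 p; first by rewrite -B0.
have [->|/set0P[x0 _]] := eqVneq B set0; first by exists 0.
have : near_covering (closure (i @` B)) by exact/compact_near_coveringP.
move=> /(_ R (+oo) (fun M p => exists2 x, mdist x0 x <= M & i x = p)) [].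
  move=> p /sB[x _ <-].
  exists (i @` (ball x 1)°, [set M | mdist x0 x + 1 <= M]).
    split; last by apply: nbhs_pinfty_ge; exact: num_real.
    apply: open_nbhs_nbhs; split; last by exists x => //; exact: nbhsx_ballx.
    by apply: ci_open; exact: open_interior.
  move=> [_ M] [[y /interior_subset xy <-]] /= hM; exists y => //.
  move: xy; rewrite ballEmdist/= => /ltW xy.
  by rewrite (le_trans (metric_triangle x0 x y))// (le_trans _ hM)// lerD2l.
move=> M [_ hM]; apply: (@metric_bounded_of_center _ _ _ x0 (M + 1)) => y By.
have cBy : closure (i @` B) (i y) by apply: subset_closure; exists y.
have M1 : M < M + 1 by rewrite ltrDl.
by have [z zM /ci_inj <-] := hM _ M1 _ cBy.
Qed.

Lemma unbounded_boundary_point B : ~ metric_bounded B ->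
  exists2 p, closure (i @` B) p & boundary i p.
Proof.
move=> uB; have /set0P[p [cp bp]] : closure (i @` B) `&` boundary i != set0.
  by apply/eqP => /metric_boundedP.
by exists p.
Qed.

Lemma boundary_rel_refl B : boundary_rel i B B <-> ~ metric_bounded B.
Proof.
split=> [[p [Bp _]]|/unbounded_boundary_point[p cp bp]]; last by exists p.
by move=> /metric_boundedP B0; have : set0 p by rewrite -B0.
Qed.

Lemma boundary_relS A B C :
  A `<=` B -> boundary_rel i A C -> boundary_rel i B C.
Proof.
move=> AB [p [[Ap bp] Cp]]; exists p; split => //; split => //.
by apply: closureS Ap; exact: image_subset.
Qed.

(** A net in [A] converging to [p], indexed by the neighbourhoods of [p], is
    followed at bounded distance by a net in [A'], which then clusters at [p]
    by coarseness. *)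
Lemma coarse_closure_transfer A A' E p : coarse_compactification i ->
  coarse_entourage E -> A `<=` thicken E A' -> boundary i p ->
  closure (i @` A) p -> closure (i @` A') p.
Proof.
move=> ic [M hM] AA' bp cp.
pose I := {U : set Y | nbhs p U}.
pose le (U V : I) := sval V `<=` sval U.
have pick (U : I) : {xy : X * X |
    [/\ A xy.1, sval U (i xy.1), A' xy.2 & E xy]}.
  apply: cid; case: U => U pU /=.
  have [_ [[x Ax <-] Ux]] := cp _ pU.
  by have [y A'y Exy] := AA' _ Ax; exists (x, y).
pose x U := (sval (pick U)).1; pose y U := (sval (pick U)).2.
have dI : directed le.
  split => //.
  - by apply: inhabits; exists setT; exact: filterT.
  - by move=> U.
  - by move=> U V W UV VW; exact: (subset_trans VW UV).
  - move=> [U pU] [V pV]; have pUV : nbhs p (U `&` V) by exact: filterI.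
    by exists (exist _ (U `&` V) pUV); [exact: subIsetl|exact: subIsetr].
have exy : coarse_entourage (range (fun U => (x U, y U))).
  exists M => _ _ [U _ [<- <-]]; apply: hM; rewrite /x /y.
  by case: (pick U) => -[] ? ? [].
have : (cluster (net_filter le (i \o x)) `&` boundary i) p.
  split => // V W [k hV] pW.
  pose kW : I := exist _ W pW; have [_ _ _ /(_ k kW)[m km Wm]] := dI.
  exists (i (x m)); split; first exact: hV.
  by apply: Wm; rewrite /x; case: (pick m) => ? [].
rewrite (ic _ _ dI _ _ exy) => -[cy _] W pW.
apply: cy pW; have [[k] _ _ _] := dI.
exists k => m _; exists (y m) => //.
by rewrite /y; case: (pick m) => ? [].
Qed.

(** For the splitting axiom, normality of [Y] gives a set [U] around the boundary
    points of [A] whose closure contains no boundary point of [B]; its trace on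
    [X] and the complement of that trace are the two halves. *)
Lemma coarse_proximity :
  coarse_compactification i -> large_scale_proximity (boundary_rel i).
Proof.
move=> ic; split.
- by move=> B; rewrite boundary_rel_refl; split => [/contrapT//|? []].
- by move=> A B [p [Ap Bp]]; exists p.
- move=> A A' E Ec _ AA' B [p [[Ap bp] Bp]]; exists p; split => //; split => //.
  exact: (coarse_closure_transfer ic Ec AA' bp Ap).
- move=> A B C; split=> [|[]].
  + move=> [p []]; rewrite image_setU closureU => -[[Ap|Bp] bp] Cp.
      by left; exists p.
    by right; exists p.
  + by apply: boundary_relS; exact: subsetUl.
  + by apply: boundary_relS; exact: subsetUr.
- move=> A B AB.
  pose bd (C : set X) := closure (i @` C) `&` boundary i.
  have cbd C : closed (bd C).
    by apply: closedI; [exact: closed_closure|exact: closed_boundary].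
  have /compact_normal := ci_hausdorff.
  move=> /(_ ci_compact _ (cbd A) (~` bd B))[].
    move=> p Ap; apply: open_nbhs_nbhs; split; first exact/closed_openC/cbd.
    by move=> Bp; apply: AB; exists p.
  move=> U AU UB.
  exists (i @^-1` ~` U), (i @^-1` U); split.
  + by rewrite -preimage_setU setUC setUv.
  + move=> [p [[Cp _] Ap]]; have [_ [[x nUx <-] Ux]] := Cp _ (AU _ Ap).
    exact: nUx.
  + move=> [p [[Dp _] Bp]]; apply: (UB p) => //.
    by apply: closureS Dp => _ [x Ux <-].
Qed.

Lemma metric_boundedU A B :
  metric_bounded A -> metric_bounded B -> metric_bounded (A `|` B).
Proof.
rewrite !metric_boundedP => A0 B0.
by rewrite image_setU closureU setIUl A0 B0 setU0.
Qed.

(** If [f] is not Higson, the pairs violating the condition outside ever larger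
    bounded sets accumulate at some [(p, q)] in the square of [Y].  The sets
    [A] and [A'] of coordinates of such pairs near [p] and [q] are at bounded
    distance, and [A] has the boundary point [p], so that [A] and [A'] share a
    boundary point; there the extension of [f] is close to both [g p] and
    [g q]. *)
Lemma proximity_higson f : large_scale_proximity (boundary_rel i) ->
  extendable i f -> higson f.
Proof.
move=> ir [fb fc [g gc gf]]; split => // E [M hM] e e0.
apply: contrapT => nK.
pose P K : set (X * X) := [set xy |
  [/\ E xy, ~ (K xy.1 /\ K xy.2) & e <= `|f xy.1 - f xy.2|]].
have P_nonempty K : metric_bounded K -> P K !=set0.
  move=> Kb; apply: contrapT => P0; apply: nK; exists K => // x y Exy Kxy.
  by rewrite ltNge; apply/negP => fxy; apply: P0; exists (x, y).
pose G := filter_from metric_bounded P.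
have GG : ProperFilter G.
  apply: filter_from_proper => //; apply: filter_from_filter.
    by exists set0; exists 0.
  move=> K L Kb Lb; exists (K `|` L); first exact: metric_boundedU.
  move=> -[x y] [/= Exy KLxy fxy]; split; split => //=; apply: contra_not KLxy.
    by move=> [Kx Ky]; split; left.
  by move=> [Lx Ly]; split; right.
pose ii (xy : X * X) : Y * Y := (i xy.1, i xy.2).
have [] := compact_setX ci_compact ci_compact (F := ii @ G).
  exact: filterE.
move=> [p q] [_ pq].
have near_pq K U V : metric_bounded K -> nbhs p U -> nbhs q V ->
    exists2 xy, P K xy & U (i xy.1) /\ V (i xy.2).
  move=> Kb pU qV.
  have GP : (ii @ G) [set ii xy | xy in P K].
    by exists K => // xy Pxy; exists xy.
  have UV : nbhs (p, q) (U `*` V) by exists (U, V).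
  by have [_ [[xy Pxy <-] [/= Ux Vy]]] := pq _ _ GP UV; exists xy.
(* At a common boundary point the extension is within 2d of both g p and
   g q, and the values of f at a pair near (p, q) differ from these by less
   than d each, so that these two values differ by less than 6d. *)
pose d := e / 6.
have d0 : 0 < d by rewrite divr_gt0.
have near_g z : nbhs z (g @^-1` ball (g z) d).
  by apply: gc; exact: nbhsx_ballx.
have gix x : g (i x) = f x by rewrite -gf.
pose Q x y := [/\ E (x, y), ball (g p) d (f x) & ball (g q) d (f y)].
pose A := [set x | exists y, Q x y]; pose A' := [set y | exists x, Q x y].
have bp : boundary i p.
  move=> [x0 _ ip].
  have /near_pq/(_ _ (near_g q)) : metric_bounded
      [set x | mdist x0 x <= 1 + `|M|].
    exact: (@metric_bounded_of_center _ _ _ x0 (1 + `|M|)).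
  move=> /(_ (i @` (ball x0 1)°))[].
    apply: open_nbhs_nbhs; split; first exact/ci_open/open_interior.
    by exists x0 => //; exact: nbhsx_ballx.
  move=> [x y] [/hM/= xy + _] [[x' /interior_subset x0x /ci_inj xx'] _].
  move: x0x; rewrite xx' ballEmdist/= => x0x; apply; split.
    by rewrite (le_trans (ltW x0x))// lerDl.
  rewrite (le_trans (metric_triangle x0 x y))// lerD// ?(ltW x0x)//.
  by rewrite (le_trans xy)// ler_norm.
have Ap : closure (i @` A) p.
  move=> U pU.
  have [|[x y] [/= Exy _ _] [[Ux gx] gy]] :=
      near_pq set0 _ _ _ (filterI pU (near_g p)) (near_g q).
    by exists 0.
  by exists (i x); split => //; exists x => //; exists y; split;
    rewrite -?gix.
have bd_xy x y : Q x y -> mdist x y <= M by move=> [/hM].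
have [z [[A'z _] [Az _]]] : boundary_rel i A' A.
  have rAA : boundary_rel i A A by exists p.
  apply: (lsp_coarse ir (coarse_dist_entourage M) _ _ rAA).
    move=> y [x Qxy]; exists x; first by exists y.
    by rewrite /dist_entourage/= metric_sym; exact: (bd_xy _ _ Qxy).
  by move=> x [y Qxy]; exists y; [exists x|exact: (bd_xy _ _ Qxy)].
have [_ [[x [y [_ + _]] <-] +]] := Az _ (near_g z).
have [_ [[y' [x' [_ _ +]] <-] +]] := A'z _ (near_g z).
have [|[u v] [/= _ _ +] [+ +]] := near_pq set0 _ _ _ (near_g p) (near_g q).
  by exists 0.
rewrite /= !gix /ball/= !ltr_distl ler_normr => fuv.
do 6 move=> /andP[? ?].
have : e = 6 * d by rewrite /d; field.
by case/orP: fuv; lra.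
Qed.

(** Restricting the index set to the steps where the first net is close to [p]
    gives a filter along which the second net clusters at some [q].  Since [p]
    is on the boundary, the first net leaves every bounded set along this
    filter, and a Higson function asymptotically takes the same values on both
    nets.  Hence no extension of a Higson function separates [p] from [q]. *)
Lemma separation_coarse :
  (forall p q, p <> q -> exists f g,
    [/\ higson f, continuous g, g \o i = f & g p <> g q :> R]) ->
  coarse_compactification i.
Proof.
move=> sep; apply: coarse_compactification_sub => I le dI x y xy p [px bp].
have [[k0] le_refl le_trans le_dir] := dI.
pose H := filter_from [set kU : I * set Y | nbhs p kU.2]
  (fun kU => [set k | le kU.1 k /\ kU.2 (i (x k))]).
have HH : ProperFilter H.
  apply: filter_from_proper; first apply: filter_from_filter.
  - by exists (k0, setT); exact: filterT.
  - move=> [k U] [l V] /= pU pV; have [m km lm] := le_dir k l.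
    exists (m, U `&` V); first exact: filterI.
    move=> n [/= mn [Un Vn]].
    by split; split => //; [exact: le_trans mn|exact: le_trans mn].
  - move=> [k U] /= pU.
    have [|_ [[l kl <-] Ul]] := px [set i (x l) | l in le k] U _ pU.
      by exists k => l kl; exists l.
    by exists l.
have [] := ci_compact (F := (i \o y) @ H); first exact: filterE.
move=> q [_ qy].
suff pq : p = q.
  move: qy; rewrite -pq => py A U [k kA] pU; apply: py pU.
  by exists (k, setT); [exact: filterT|move=> l [/= kl _]; exact: kA].
apply: contrapT => /sep[f [g [fh gc gf gpq]]].
have gix x' : g (i x') = f x' by rewrite -gf.
(* The three errors are g p - f (x k), f (x k) - f (y k) and f (y k) - g q. *)
pose d := `|g p - g q| / 3.
have d0 : 0 < d by rewrite divr_gt0// normr_gt0 subr_eq0; exact/eqP.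
have [_ _ /(_ _ xy _ d0)[K Kb hK]] := fh.
have near_g z : nbhs z (g @^-1` ball (g z) d).
  by apply: gc; exact: nbhsx_ballx.
pose B := [set k | (~ K (x k)) /\ ball (g p) d (f (x k))].
have HB : ((i \o y) @ H) [set i (y k) | k in B].
  exists (k0, ~` (i @` K) `&` g @^-1` ball (g p) d) => /=.
    by apply: filterI; [exact: nbhs_boundary_bounded|exact: near_g].
  move=> k [_ [nKx gx]]; exists k => //; split; last by rewrite -gix.
  by move=> Kx; apply: nKx; exists (x k).
have [_ [[k [nKx gx] <-] gy]] := qy _ _ HB (near_g q).
have : `|f (x k) - f (y k)| < d by apply: hK; [exists k|case].
move: gx gy; rewrite /= gix /ball/= => gx gy fxy.
suff : `|g p - g q| < d + d + d.
  by rewrite /d; apply/negP; rewrite -leNgt; lra.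
move: gx gy fxy; rewrite !ltr_distl => /andP[? ?] /andP[? ?] /andP[? ?].
by apply/andP; split; lra.
Qed.

(** The restriction to [X] of a Urysohn function on [Y] is extendable, hence
    Higson, and Urysohn functions separate the points of [Y]. *)
Lemma higson_coarse :
  (forall f, extendable i f -> higson f) -> coarse_compactification i.
Proof.
move=> fh; apply: separation_coarse => p q pq.
have closed1 (z : Y) : closed [set z].
  by apply: accessible_closed_set1; exact: hausdorff_accessible.
have pq0 : [set p] `&` [set q] = set0.
  by rewrite -subset0 => z [-> qp]; exact: pq.
have /normal_uniform_separator := compact_normal ci_hausdorff ci_compact.
move=> /(_ _ _ (closed1 p) (closed1 q) pq0).
move=> /(@uniform_separatorP _ R)[g [gc g01 gp gq]].
exists (g \o i), g; split => //; last first.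
  have -> : g p = 0 by apply: gp; exists p.
  have -> : g q = 1 by apply: gq; exists q.
  by apply/eqP; rewrite eq_sym oner_eq0.
apply: fh; split; last by exists g.
  exists 1; split => // M M1 x _ /=.
  have /g01 : range g (g (i x)) by exists (i x).
  rewrite /= in_itv/= => /andP[g0 g1].
  by rewrite ger0_norm// (le_trans g1)// ltW.
by move=> x; apply: continuous_comp; [exact: ci_continuous|exact: gc].
Qed.

End Boundary.

(** * Large-scale proximity relations *)

Section Proximity.
Context {R : realType} {X : metricType R} {r : set X -> set X -> Prop}.
Hypothesis lr : large_scale_proximity r.
Implicit Types (A B C K : set X).

Lemma prox_subl A B C : A `<=` B -> r A C -> r B C.
Proof.
move=> AB AC; have -> : B = A `|` B.
  by apply/seteqP; split=> x; [right|case=> // /AB].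
by apply/(lsp_union lr); left.
Qed.

Lemma prox_subr A B C : A `<=` B -> r C A -> r C B.
Proof. by move=> AB /(lsp_sym lr) /(prox_subl AB) /(lsp_sym lr). Qed.

Lemma prox_refl A : ~ metric_bounded A -> r A A.
Proof. by move=> nA; apply: contrapT => /(lsp_bounded lr). Qed.

(** The splitting axiom for [K] and [K] itself shows that the whole space is
    not related to [K]. *)
Lemma prox_bounded K B : metric_bounded K -> ~ r K B.
Proof.
move=> /(lsp_bounded lr) /(lsp_split lr)[C [D [CD CK DK]]] KB.
have : r setT K by apply: (@prox_subl B) => //; exact: lsp_sym KB.
by rewrite -CD => /(lsp_union lr)[].
Qed.

Lemma prox_thicken M A B : r (thicken (dist_entourage M) A) B -> r A B.
Proof.
(* The bound M may be negative, and then the thickening does not contain A. *)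
pose N := Num.max 0 M.
have le_N x y : mdist x y <= M -> mdist x y <= N.
  by move=> h; rewrite (le_trans h)// le_max lexx orbT.
move=> rAB.
have : r (thicken (dist_entourage M) A `|` A) B.
  by apply: prox_subl rAB; exact: subsetUl.
apply: (lsp_coarse lr (coarse_dist_entourage N)) => x.
  move=> Ax; exists x; first by right.
  by rewrite /dist_entourage/= mdistxx le_max lexx.
move=> [[y Ay xy]|Ax]; first by exists y => //; exact: le_N.
by exists x => //; rewrite /dist_entourage/= mdistxx le_max lexx.
Qed.

Lemma prox_closure A B : r (closure A) B -> r A B.
Proof.
move=> rAB; apply: (@prox_thicken 1); apply: prox_subl rAB => x Ax.
have [y [Ay]] := Ax _ (nbhsx_ballx x 1 ltr01).
by rewrite ballEmdist => /ltW xy; exists y.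
Qed.

End Proximity.

(** * The compactification defined by a large-scale proximity relation *)

Section ProximitySpace.
Context {R : realType} {X : metricType R} {r : set X -> set X -> Prop}.
Context {S : set X}.
Hypothesis X_proper : proper_metric X.
Hypothesis lr : large_scale_proximity r.
Hypothesis dS : delone S.
Implicit Types (A B C K : set X) (s t u : nonprincipal_ultrafilter S).
Implicit Types (c : prox_boundary r S) (z : prox_space r S).

Let ultra s : UltraFilter (sval s). Proof. by case: s => ? []. Qed.
Let proper s : ProperFilter (sval s). Proof. exact: ultra_proper. Qed.

(** An ultrafilter on [S] carried by a bounded set would cluster at a point of
    [X], by properness.  As the points of [S] are uniformly separated, a small
    ball around that point contains one of them only, and the ultrafilter would
    be principal. *)
Lemma ultra_unbounded s (B : set S) :
  sval s B -> ~ metric_bounded (set_val @` B).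
Proof.
move=> sB /X_proper cB; have [[e e0 Se] _] := dS.
have sP := proper s.
have [|x [_ sx]] := cB (set_val @ sval s).
  by apply: filterS sB => b Bb; apply: subset_closure; exists b.
pose T : set S := [set b | ball x (e / 2) (set_val b)].
have e2 : 0 < e / 2 by rewrite divr_gt0.
have sT : sval s T.
  have [//|sT] := in_ultra_setVsetC T (ultra s).
  have : (set_val @ sval s) (set_val @` (~` T)).
    by apply: filterS sT => b Tb; exists b.
  by move=> /sx/(_ (nbhsx_ballx x _ e2))[_ [[b Tb <-]]].
have [b0 Tb0] := filter_ex sT.
have [_ /(_ b0)] := proj2_sig s; apply.
apply: (@max_filter _ _ (principal_filter_ultra b0)) => // U.
move=> /principal_filterP Ub0.
apply: filterS sT => b Tb; suff -> : b = b0 by [].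
apply: val_inj; apply: contrapT => bb0.
have := Se _ _ (set_valP b) (set_valP b0) bb0.
have := ball_triangle (ball_sym Tb) Tb0; rewrite ballEmdist/= -splitr.
by move=> h1 h2; have := lt_le_trans h1 h2; rewrite ltxx.
Qed.

(** Membership of the class of [s] in [prox_cl A], expressed on the
    representative [s]. *)
Definition near_ultra A s : Prop :=
  forall B : set S, sval s B -> r A (set_val @` B).

Lemma ultra_cover s C D : C `|` D = setT ->
  (exists2 B, sval s B & set_val @` B `<=` C) \/
  (exists2 B, sval s B & set_val @` B `<=` D).
Proof.
move=> CD; have [sC|sC] := in_ultra_setVsetC (set_val @^-1` C) (ultra s).
  by left; exists (set_val @^-1` C) => // _ [b ? <-].
right; exists (~` (set_val @^-1` C)) => // _ [b Cb <-].
by have : (C `|` D) (set_val b); [rewrite CD|case].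
Qed.

(** If [A] and [C] were not related, one half of a splitting of [X] would carry
    [s] without being related to [A], respectively to [C]. *)
Lemma near_ultra_prox s A C : near_ultra A s -> near_ultra C s -> r A C.
Proof.
move=> As Cs; apply: contrapT => /(lsp_split lr)[D [D' [DD' DA D'C]]].
case: (ultra_cover s DD') => -[B sB BD].
  by apply: DA; apply: (prox_subl lr BD); apply: (lsp_sym lr); exact: As.
by apply: D'C; apply: (prox_subl lr BD); apply: (lsp_sym lr); exact: Cs.
Qed.

Lemma near_ultra_rel s t A :
  ultra_rel r s t -> near_ultra A s -> near_ultra A t.
Proof.
move=> st As B tB; apply: contrapT => /(lsp_split lr)[D [D' [DD' DA D'B]]].
case: (ultra_cover s DD') => -[C sC CD].
  by apply: DA; apply: (prox_subl lr CD); apply: (lsp_sym lr); exact: As.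
by apply: D'B; apply: (prox_subl lr CD); exact: st.
Qed.

Lemma near_ultraU s A B :
  near_ultra (A `|` B) s <-> near_ultra A s \/ near_ultra B s.
Proof.
have sP := proper s.
split=> [AB|[] As C sC]; last 2 first.
- by apply: prox_subl (As _ sC) => //; exact: subsetUl.
- by apply: prox_subl (As _ sC) => //; exact: subsetUr.
apply: contrapT => /not_orP[/existsNP[C /not_implyP[sC AC]]].
move=> /existsNP[D /not_implyP[sD BD]].
have [CD|CD] := (lsp_union lr _ _ _).1 (AB _ (filterI sC sD)).
  by apply: AC; apply: prox_subr CD => //; apply: image_subset => x [].
by apply: BD; apply: prox_subr CD => //; apply: image_subset => x [].
Qed.

Lemma ultra_rel_refl s : ultra_rel r s s.
Proof.
have sP := proper s.
move=> A B sA sB; have sAB : sval s (A `&` B) by exact: filterI.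
have := prox_refl lr (ultra_unbounded sAB).
by move=> /(prox_subl lr (image_subset _ (@subIsetl _ A B)))
  /(prox_subr lr (image_subset _ (@subIsetr _ A B))).
Qed.

Lemma ultra_rel_sym s t : ultra_rel r s t -> ultra_rel r t s.
Proof. by move=> st A B tA sB; apply: (lsp_sym lr); exact: st. Qed.

Lemma ultra_rel_trans s t u :
  ultra_rel r s t -> ultra_rel r t u -> ultra_rel r s u.
Proof.
by move=> st tu A B sA uB; apply: (near_ultra_rel tu _ uB) => C tC; exact: st.
Qed.

Lemma ultra_classP s t : ultra_class r s = ultra_class r t <-> ultra_rel r s t.
Proof.
split=> [st|st].
  have : ultra_class r t t by exact: ultra_rel_refl.
  by rewrite -st.
apply/seteqP; split=> u; last exact: ultra_rel_trans.
by apply: ultra_rel_trans; exact: ultra_rel_sym.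
Qed.

Lemma prox_clP A c s :
  sval c = ultra_class r s -> prox_cl A c <-> near_ultra A s.
Proof.
move=> cs; split=> [[t ct At]|As]; last by exists s.
by apply: near_ultra_rel At; apply/ultra_classP; rewrite -ct.
Qed.

Lemma prox_boundary_rep c : exists s, sval c = ultra_class r s.
Proof. by have [s _ cs] := proj2_sig c; exists s. Qed.

Lemma prox_clU A B : @prox_cl R X r S (A `|` B) = prox_cl A `|` prox_cl B.
Proof.
apply/seteqP; split=> c; have [s cs] := prox_boundary_rep c;
  by rewrite /setU/= !(prox_clP _ cs) near_ultraU.
Qed.

Lemma prox_cl_bounded K : metric_bounded K -> @prox_cl R X r S K = set0.
Proof.
move=> Kb; rewrite -subset0 => c [s _ Ks]; have sP := proper s.
apply: (prox_bounded lr Kb (B := set_val @` [set: S])).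
by apply: Ks; exact: filterT.
Qed.

Lemma prox_clT : @prox_cl R X r S setT = setT.
Proof.
apply/seteqP; split=> // c _; have [s cs] := prox_boundary_rep c.
apply/(prox_clP _ cs) => B sB.
by apply: (prox_subl lr _ (prox_refl lr (ultra_unbounded sB))).
Qed.

Lemma prox_closedU A B :
  @prox_closed R X r S (A `|` B) = prox_closed A `|` prox_closed B.
Proof. by rewrite /prox_closed prox_clU closureU !image_setU setUACA. Qed.

Lemma prox_closed_bounded K : metric_bounded K ->
  @prox_closed R X r S K = inl @` closure K.
Proof.
by move=> Kb; rewrite /prox_closed prox_cl_bounded// image_set0 setU0.
Qed.

Lemma prox_closedT : @prox_closed R X r S setT = setT.
Proof.
rewrite /prox_closed prox_clT closureT.
by apply/seteqP; split=> // -[x|c] _; [left; exists x|right; exists c].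
Qed.

Lemma prox_closedS A B : A `<=` B ->
  @prox_closed R X r S A `<=` prox_closed B.
Proof.
move=> AB; have -> : B = A `|` B.
  by apply/seteqP; split=> x; [right|case=> // /AB].
by rewrite prox_closedU; exact: subsetUl.
Qed.

Lemma prox_closed_inl A x : @prox_closed R X r S A (inl x) <-> closure A x.
Proof. by split=> [[[y Ay [<-]]|[]]//|Ax]; left; exists x. Qed.

Lemma prox_closed_inr A c : prox_closed A (inr c) <-> prox_cl A c.
Proof. by split=> [[[]//|[c' Ac [<-]]]//|Ac]; right; exists c. Qed.

Lemma closed_prox_closed A : closed (@prox_closed R X r S A).
Proof.
rewrite -[X in closed X]setCK; apply: open_closedC.
exists [set ~` prox_closed A]; last by rewrite bigcup_set1.
move=> _ ->; exists [fset A]%fset; first by move=> B _; rewrite in_setT.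
by rewrite set_fset1 bigcap_set1.
Qed.

(** The sets [prox_closed A] are stable under finite unions, so the
    complements, given as a subbase, form a base. *)
Lemma prox_nbhsP z (U : set (prox_space r S)) :
  nbhs z U <-> exists2 A, ~ prox_closed A z & ~` prox_closed A `<=` U.
Proof.
split=> [|[A nAz AU]]; last first.
  apply: (filterS AU); apply: open_nbhs_nbhs; split => //.
  exact/closed_openC/closed_prox_closed.
rewrite nbhsE => -[V [[D DI <-] [W DW Wz]] VU].
have [J _ JW] := DI _ DW.
suff [A AE] : exists A, forall w : prox_space r S,
    prox_closed A w <-> exists2 B : set X, B \in enum_fset J & prox_closed B w.
  exists A; first by move=> /AE[B BJ Bz]; move: Wz; rewrite -JW => /(_ _ BJ).
  move=> w Aw; apply: VU; exists W => //.
  suff : W w by []; rewrite -JW => B BJ Bw.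
  by apply: Aw; apply/AE; exists B.
elim: (enum_fset J) => [|B l [A Al]].
  exists set0 => w; rewrite prox_closed_bounded; last by exists 0.
  by rewrite closure0 image_set0; split=> // -[].
exists (B `|` A) => w; rewrite prox_closedU; split.
  move=> [Bw|/Al[C Cl Cw]]; first by exists B; rewrite ?mem_head.
  by exists C; rewrite // in_cons Cl orbT.
move=> [C]; rewrite in_cons => /orP[/eqP->|Cl] Cw; first by left.
by right; apply/Al; exists C.
Qed.

Let embed : X -> prox_space r S := prox_embed r S.

Lemma prox_embed_continuous : continuous embed.
Proof.
move=> x U /prox_nbhsP[A nAx AU]; apply: (@filterS _ _ _ (~` closure A)).
  by move=> y nAy; apply: AU => /prox_closed_inl.
apply: open_nbhs_nbhs; split; first exact/closed_openC/closed_closure.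
by move=> Ax; apply/nAx/prox_closed_inl.
Qed.

(** For [A] the complement of a ball, [prox_cl A] is the whole boundary because
    balls are bounded, so that the complement of [prox_closed A] consists of
    points of the ball. *)
Lemma prox_embed_open (U : set X) : open U -> open (embed @` U).
Proof.
move=> oU; rewrite openE => _ [x Ux <-]; apply/prox_nbhsP.
have /nbhs_ballP[e /= e0 eU] : nbhs x U by exact: open_nbhs_nbhs.
exists (~` ball x e).
  move=> /prox_closed_inl/(_ _ (nbhsx_ballx x e e0))[y []]; exact.
move=> [y nAy|c nAc].
  exists y => //; apply: eU; apply: contrapT => xy.
  by apply: nAy; apply/prox_closed_inl; exact: subset_closure.
exfalso; apply: nAc; apply/prox_closed_inr.
have : prox_cl [set: X] c by rewrite prox_clT.
rewrite -(setvU (ball x e)) prox_clU (@prox_cl_bounded (ball x e)) ?setU0//.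
exact: metric_bounded_ball.
Qed.

(** A boundary point outside [prox_closed A] comes from an ultrafilter with a
    member [B] that is not related to [A].  As [B] is unbounded, it is related
    to itself, so it is not contained in the closure of [A]. *)
Lemma prox_embed_dense : dense (range embed).
Proof.
move=> U [z Uz] oU.
have /prox_nbhsP[A nAz AU] : nbhs z U by exact: open_nbhs_nbhs.
case: z Uz nAz => [x Ux _|c _ nAc].
  by exists (inl x); split => //; exists x.
have [s cs] := prox_boundary_rep c.
have : ~ near_ultra A s.
  by move=> /(prox_clP _ cs) Ac; apply: nAc; apply/prox_closed_inr.
move=> /existsNP[B /not_implyP[sB nAB]].
have [x [Bx nAx]] : (set_val @` B) `&` ~` closure A !=set0.
  apply: contrapT => BA; apply: nAB; apply: prox_closure => //.
  apply: (prox_subl lr _ (prox_refl lr (ultra_unbounded sB))).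
  by move=> x Bx; apply: contrapT => Ax; apply: BA; exists x.
exists (inl x); split; last by exists x.
by apply: AU => /prox_closed_inl.
Qed.

(** The complements of [prox_closed A] and [prox_closed B] are disjoint when [A]
    and [B] cover [X]; this is how the splitting axiom yields the Hausdorff
    property. *)
Lemma prox_separated z w A B : A `|` B = setT ->
  ~ prox_closed A z -> ~ prox_closed B w -> ~ cluster (nbhs z) w.
Proof.
move=> AB nAz nBw zw.
have zA : nbhs z (~` prox_closed A) by apply/prox_nbhsP; exists A.
have wB : nbhs w (~` prox_closed B) by apply/prox_nbhsP; exists B.
have [v [Av Bv]] := zw _ _ zA wB.
have : prox_closed (A `|` B) v by rewrite AB prox_closedT.
by rewrite prox_closedU => -[].
Qed.

Lemma prox_hausdorff : hausdorff_space (prox_space r S).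
Proof.
have inlr x c : ~ cluster (nbhs (inl x : prox_space r S)) (inr c).
  apply: (@prox_separated _ _ (~` ball x 1) (ball x 1)); first exact: setvU.
    move=> /prox_closed_inl/(_ _ (nbhsx_ballx x 1 ltr01))[y []]; exact.
  move=> /prox_closed_inr.
  by rewrite prox_cl_bounded//; exact: metric_bounded_ball.
move=> [x|c] [y|d].
- move=> xy; congr inl; apply: (@metric_hausdorff _ X) => U V xU yV.
  have [U' [oU' xU' U'U]] : exists U', [/\ open U', U' x & U' `<=` U].
    by move: xU; rewrite nbhsE => -[U' [? ?] ?]; exists U'.
  have [V' [oV' yV' V'V]] : exists V', [/\ open V', V' y & V' `<=` V].
    by move: yV; rewrite nbhsE => -[V' [? ?] ?]; exists V'.
  have nU : nbhs (inl x : prox_space r S) (embed @` U').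
    by apply: open_nbhs_nbhs; split; [exact: prox_embed_open|exists x].
  have nV : nbhs (inl y : prox_space r S) (embed @` V').
    by apply: open_nbhs_nbhs; split; [exact: prox_embed_open|exists y].
  have [_ [[v Uv <-] [w Vw [wv]]]] := xy _ _ nU nV.
  by exists v; split; [exact: U'U|apply: V'V; rewrite -wv].
- by move=> /inlr.
- by rewrite -closeEnbhs => /close_sym; rewrite closeEnbhs => /inlr.
- move=> cd; congr inr; apply: contrapT => ncd.
  have [s cs] := prox_boundary_rep c; have [t dt] := prox_boundary_rep d.
  have : ~ ultra_rel r s t.
    move=> /ultra_classP st; apply: ncd.
    by apply: eq_sig_hprop => [? ? ?|]; [exact: Prop_irrelevance|rewrite cs dt].
  move=> /existsNP[A /existsNP[B /not_implyP[sA /not_implyP[tB]]]].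
  move=> /(lsp_split lr)[C [D [CD CA DB]]].
  apply: (@prox_separated (inr c) (inr d) C D) cd => //.
    by move=> /prox_closed_inr/(prox_clP _ cs)/(_ _ sA).
  by move=> /prox_closed_inr/(prox_clP _ dt)/(_ _ tB).
Qed.

(** The intersection of the two closed sets either has a boundary point, whose
    ultrafilters are near both [A] and [B], or is carried by the intersection of
    the closures in [X], which is then unbounded and hence related to
    itself. *)
Lemma ultra_prox_closed (F : set_system (prox_space r S)) A B :
  UltraFilter F -> (forall K, metric_bounded K -> ~ F (prox_closed K)) ->
  F (prox_closed A) -> F (prox_closed B) -> r A B.
Proof.
move=> FU Funbounded FA FB.
have FAB : F (prox_closed A `&` prox_closed B) by exact: filterI.
have [[c [Ac Bc]]|AB0] := pselect (@prox_cl R X r S A `&` prox_cl B !=set0).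
  have [s cs] := prox_boundary_rep c.
  by apply: (@near_ultra_prox s); apply/(prox_clP _ cs).
have ub : ~ metric_bounded (closure A `&` closure B).
  move=> /Funbounded; apply; apply: filterS FAB => -[x|c] [].
    move=> /prox_closed_inl Ax /prox_closed_inl Bx; apply/prox_closed_inl.
    exact: subset_closure.
  move=> /prox_closed_inr Ac /prox_closed_inr Bc; exfalso; apply: AB0.
  by exists c.
apply: (prox_closure lr); apply: (lsp_sym lr); apply: (prox_closure lr).
apply: (prox_subl lr (@subIsetr _ (closure A) _)).
by apply: (prox_subr lr (@subIsetl _ _ (closure B))); exact: prox_refl.
Qed.

(** Call a subset of [S] charged when [prox_closed] of its thickening belongs to
    the ultrafilter [F].  If a union of two sets is charged, so is one of them;
    hence the sets whose complement is not charged form a filter [G], and an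
    ultrafilter [s] finer than [G] consists of charged sets.  Thickening by [M]
    is needed because [F] may live away from [S]; it does not affect [r].
    Every [A] with [prox_closed A] in [F] is then related to every member of
    [s], which is convergence of [F] to the class of [s].  This assumes that
    [F] does not contain [prox_closed K] for any bounded [K]; if it does, it
    converges in [X] by properness. *)
Lemma prox_compact : compact [set: prox_space r S].
Proof.
rewrite compact_ultra => F FU _.
have [[K [Kb FK]]|/forallNP F_unbounded] :=
    pselect (exists K, metric_bounded K /\ F (prox_closed K)).
  have : compact (embed @` closure K).
    apply: continuous_compact (X_proper Kb).
    by apply/continuous_subspaceT/prox_embed_continuous.
  rewrite compact_ultra => /(_ F FU)[].
    by rewrite -prox_closed_bounded.
  by move=> z [_ Fz]; exists z.
have {}F_unbounded K : metric_bounded K -> ~ F (prox_closed K).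
  by move=> Kb FK; apply: (F_unbounded K).
have [_ [E [M hM] ES]] := dS.
pose th (T : set S) := thicken (dist_entourage M) (set_val @` T).
have thS (T T' : set S) : T `<=` T' -> th T `<=` th T'.
  move=> TT' x [_ [b Tb <-] xb]; exists (set_val b) => //.
  by exists b => //; exact: TT'.
have thU (T T' : set S) : th (T `|` T') `<=` th T `|` th T'.
  move=> x [_ [b [Tb|Tb] <-] xb]; [left|right];
    by exists (set_val b) => //; exists b.
have thT : th setT = setT.
  apply/seteqP; split=> // x _; have : thicken E S x by rewrite ES.
  move=> [y Sy /hM xy]; exists y => //.
  by exists (exist _ y (mem_set Sy)).
pose G : set_system S := [set T | ~ F (prox_closed (th (~` T)))].
have GG : ProperFilter G.
  split; first by rewrite /G/= setC0 thT prox_closedT; apply; exact: filterT.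
  split.
  - rewrite /G/= setCT; apply: F_unbounded; exists 0 => x y [_ [b []]].
  - move=> T T' GT GT'; rewrite /G/= setCI => FTT'.
    have : F (prox_closed (th (~` T)) `|` prox_closed (th (~` T'))).
      by rewrite -prox_closedU; apply: filterS FTT'; apply: prox_closedS.
    have [//|nT] := in_ultra_setVsetC (prox_closed (th (~` T))) FU.
    have [//|nT'] := in_ultra_setVsetC (prox_closed (th (~` T'))) FU.
    move=> FU'.
    have [z [[zT|zT] [nzT nzT']]] := filter_ex (filterI FU' (filterI nT nT')).
      exact: nzT.
    exact: nzT'.
  - move=> T T' TT' GT FT'; apply: GT; apply: filterS FT'.
    by apply/prox_closedS/thS/subsetC.
have [s [sU Gs]] := ultraFilterLemma GG.
have sF (B : set S) : s B -> F (prox_closed (th B)).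
  move=> sB; apply: contrapT => nFB.
  have sCB : s (~` B) by apply: Gs; rewrite /G/= setCK.
  by have [b []] := filter_ex (filterI sB sCB).
have s_nonprincipal (x : S) : s <> principal_filter x.
  move=> sx; have /sF : s [set x] by rewrite sx; exact/principal_filterP.
  apply: F_unbounded; apply: metric_bounded_thicken.
  by exists 0 => _ _ [_ -> <-] [_ -> <-]; rewrite mdistxx.
pose t : nonprincipal_ultrafilter S := exist _ s (conj sU s_nonprincipal).
have ct : range (ultra_class r (S := S)) (ultra_class r t) by exists t.
exists (inr (exist _ _ ct)); split => // U /prox_nbhsP[A nAc AU].
apply: filterS AU _.
have [FA|//] := in_ultra_setVsetC (prox_closed A) FU.
exfalso; apply: nAc; apply/prox_closed_inr/(@prox_clP _ _ t) => // B sB.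
apply: (lsp_sym lr); apply: (@prox_thicken _ _ _ lr M).
by apply: ultra_prox_closed FA => //; exact: sF.
Qed.

Lemma prox_compactification : compactification embed.
Proof.
split.
- by split; [exact: prox_compact|exact: prox_hausdorff].
- by move=> x y [].
- exact: prox_embed_continuous.
- exact: prox_embed_open.
- exact: prox_embed_dense.
Qed.

(** If the second net stayed in the closure of [A], a set not close to [c],
    while the first one clusters at [c], the tails [B] and [B'] of the two nets
    would be at bounded distance, so that [B'], and with it [A], would be
    related to all members of an ultrafilter in the class [c]. *)
Lemma prox_coarse : coarse_compactification embed.
Proof.
apply: coarse_compactification_sub => I le _ x y [M hM] [z|c] [cx bc].
  by exfalso; apply: bc; exists z.
move=> W U [k0 kW] /prox_nbhsP[A nAc AU].
apply: contrapT => WU0.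
have yA k : le k0 k -> closure A (y k).
  move=> k0k; apply/(@prox_closed_inl _ (y k)); apply: contrapT => nAy.
  by apply: WU0; exists (embed (y k)); split; [exact: kW|exact: AU].
pose B := [set x k | k in le k0]; pose B' := [set y k | k in le k0].
have cB : prox_closed B (inr c).
  rewrite [prox_closed B](closure_id _).1; last exact: closed_prox_closed.
  move=> V; apply: cx; exists k0 => k k0k; apply/prox_closed_inl.
  by apply: subset_closure; exists k.
have [s cs] := prox_boundary_rep c.
apply/nAc/prox_closed_inr/(prox_clP _ cs) => C sC.
move: cB => /prox_closed_inr/(prox_clP _ cs)/(_ _ sC) rBC.
apply: (prox_closure lr); apply: (@prox_subl _ _ _ lr B').
  by move=> _ [k k0k <-]; exact: yA.
apply: (prox_thicken lr (M := M)); apply: (prox_subl lr) rBC.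
move=> _ [k k0k <-]; exists (y k); first by exists k.
by apply: hM; exists k.
Qed.

End ProximitySpace.

(** * The compactification generated by a family of functions *)

Section BumpFunctions.
Context {R : realType} {X : metricType R}.
Implicit Types (x : X) (e : R) (f : X -> R) (K : set X).

Definition bump (x : X) (e : R) (y : X) : R := Num.max 0 (e - mdist x y).

Lemma bump_continuous x e : continuous (bump x e).
Proof.
move=> y; apply: (@continuous_max _ _ (fun=> 0) (fun z => e - mdist x z)).
  exact: cvg_cst.
by apply: cvgB; [exact: cvg_cst|exact: mdist_continuous].
Qed.

Lemma bump_bounded x e : bounded_fun (bump x e).
Proof.
exists `|e|; split; first exact: num_real.
move=> M eM y _ /=; rewrite ger0_norm ?le_max ?lexx// ge_max.
rewrite (le_trans (normr_ge0 e) (ltW eM))/=.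
rewrite (le_trans _ (ltW eM))// (le_trans _ (ler_norm e))// lerBlDr lerDl.
exact: mdist_ge0.
Qed.

Lemma bump_gt0 x e y : (0 < bump x e y) = (mdist x y < e).
Proof. by rewrite lt_max ltxx subr_gt0. Qed.

Lemma bump_support x e y : ~ ball x e y -> bump x e y = 0.
Proof.
rewrite ballEmdist/= => /negP; rewrite -leNgt => h.
by apply/max_idPl; rewrite subr_le0.
Qed.

Lemma higson_bump x e : higson (bump x e).
Proof.
split; [exact: bump_bounded|exact: bump_continuous|move=> E [M hM] d d0].
exists [set y | mdist x y <= `|e| + `|M|].
  exact: (@metric_bounded_of_center _ _ _ x (`|e| + `|M|)).
move=> y z /hM yz nK.
have le_e t : ball x e t -> mdist x t <= `|e|.
  by rewrite ballEmdist => /ltW /le_trans; apply; exact: ler_norm.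
have yzM := le_trans yz (ler_norm M).
have ny : ~ ball x e y.
  move=> /le_e xy; apply: nK; split; first by rewrite /= ler_wpDr.
  by rewrite /= (le_trans (metric_triangle x y z))// lerD.
have nz : ~ ball x e z.
  move=> /le_e xz; apply: nK; split; last by rewrite /= ler_wpDr.
  by rewrite /= (le_trans (metric_triangle x z y))// lerD// metric_sym.
by rewrite !bump_support// subrr normr0.
Qed.

End BumpFunctions.

Lemma dense_nbhs {T : topologicalType} (D : set T) (p : T) (U : set T) :
  dense D -> nbhs p U -> U `&` D !=set0.
Proof.
move=> dD; rewrite nbhsE => -[V [oV Vp] VU].
have [q [Vq Dq]] := dD V (ex_intro _ p Vp) oV.
by exists q; split=> //; exact: VU.
Qed.

(** The extension is by zero: a boundary point has a neighbourhood avoiding the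
    bounded support, and at points of [X] the embedding is open. *)
Lemma extends_bounded_support {R : realType} {X : metricType R}
    (X_proper : proper_metric X) {Y : topologicalType} (i : X -> Y)
    (ci : compactification i) (f : X -> R) (K : set X) :
  continuous f -> metric_bounded K -> (forall x, ~ K x -> f x = 0) ->
  extends i f.
Proof.
move=> fc Kb fK; have [_ i_inj _ i_open _] := ci.
pose g (y : Y) : R := if pselect (exists x, i x = y) is left h
  then f (sval (cid h)) else 0.
have gi x : g (i x) = f x.
  rewrite /g; case: pselect => [h|[]]; last by exists x.
  by case: (cid h) => x' /= /i_inj ->.
have g0 y : ~ (i @` K) y -> g y = 0.
  have [[x <-]|nx] := pselect (exists x, i x = y).
    by move=> nK; rewrite gi fK// => Kx; apply: nK; exists x.
  by rewrite /g; case: pselect.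
exists g; last by apply/funext => x; exact: gi.
move=> y; have [[x <-]|ny] := pselect (exists x, i x = y).
  move=> U; rewrite gi => /fc; rewrite nbhsE => -[V [oV Vx] VU].
  apply: (@filterS _ _ _ (i @` V)) => [_ [v /VU fv <-]|].
    by rewrite /= gi.
  by apply: open_nbhs_nbhs; split; [exact: i_open|exists x].
have by_ : boundary i y by move=> [x _ xy]; apply: ny; exists x.
move=> U gU; have := nbhs_boundary_bounded X_proper ci by_ Kb.
apply: filterS => z nz; rewrite /= g0//; rewrite g0 in gU.
  exact: nbhs_singleton.
by move=> [x _ xy]; apply: ny; exists x.
Qed.

Section GeneratedCompactification.
Context {R : realType} {X : metricType R}.
Hypothesis X_proper : proper_metric X.
Variable F : set (X -> R).
Hypothesis F_bounded : forall f, F f -> bounded_fun f.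
Hypothesis F_continuous : forall f, F f -> continuous f.

(** The bump functions make the evaluation map an open embedding; as they extend
    to every compactification, adding them to [F] leaves the generated
    compactification unchanged. *)
Definition with_bumps : set (X -> R) :=
  F `|` [set bump xe.1 xe.2 | xe in [set: X * R]].

Local Notation G := with_bumps.
Let prod : topologicalType := prod_topology (fun _ : G => R).

Lemma continuous_into_prod {T : topologicalType} (h : T -> prod) :
  (forall g, continuous (fun t => h t g)) -> continuous h.
Proof.
move=> ch t; apply/cvg_sup => g.
exact: (@continuous_comp_initial _ _ _ (@^~ g) h (ch g)).
Qed.

Lemma with_bumps_bounded f : G f -> bounded_fun f.
Proof. by move=> [/F_bounded//|[xe _ <-]]; exact: bump_bounded. Qed.

Lemma with_bumps_continuous f : G f -> continuous f.
Proof. by move=> [/F_continuous//|[xe _ <-]]; exact: bump_continuous. Qed.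

Definition evaluation (x : X) : prod := fun g => set_val g x.

Lemma evaluation_continuous : continuous evaluation.
Proof.
apply: continuous_into_prod => g.
exact: with_bumps_continuous (set_valP g).
Qed.

Definition hull : topologicalType := set_type (closure (range evaluation)).

Definition hull_embed (x : X) : hull :=
  exist _ (evaluation x) (mem_set (subset_closure (imageP evaluation I))).

Definition coordinate (g : G) (y : hull) : R := (set_val y : prod) g.

Lemma hull_valP (y : hull) :
  closure (range evaluation) ((set_val : hull -> prod) y).
Proof. exact: set_mem (proj2_sig y). Qed.

Lemma hull_val_continuous : continuous (set_val : hull -> prod).
Proof. exact: initial_continuous. Qed.

Lemma coordinate_continuous g : continuous (coordinate g).
Proof.
move=> y.
apply: (@continuous_comp _ _ _ (set_val : hull -> prod) (@proj G (fun=> R) g)).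
  exact: hull_val_continuous.
exact: proj_continuous.
Qed.

Lemma coordinate_inj y z : (forall g, coordinate g y = coordinate g z) -> y = z.
Proof. by move=> yz; apply: val_inj; apply/funext => g; exact: yz. Qed.

Lemma closure_evaluation_compact : compact (closure (range evaluation)).
Proof.
have bound (g : G) : {M : R | forall x, `|set_val g x| <= M}.
  apply: cid; have [M [_ hM]] := with_bumps_bounded (set_valP g).
  by exists (M + 1) => x; apply: hM => //; rewrite ltrDl.
pose side (g : G) : set R := `[- sval (bound g), sval (bound g)]%classic.
pose box : set prod := [set y | forall g, side g (y g)].
have box_compact : compact box.
  have := @tychonoff G (fun=> R : topologicalType) side.
  by apply => g; exact: segment_compact.
apply: (subclosed_compact _ box_compact); first exact: closed_closure.
have box_closed : closed box.
  apply: compact_closed box_compact.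
  by apply: hausdorff_product => g; exact: Rhausdorff.
rewrite [X in _ `<=` X](closure_id _).1//.
apply: closureS => _ [x _ <-] g; rewrite /side/= in_itv/= -ler_norml.
exact: (svalP (bound g)).
Qed.

Lemma hull_compact : compact [set: hull].
Proof.
move=> H HH _.
have [|a [ca aH]] :=
  closure_evaluation_compact (F := (set_val : hull -> prod) @ H).
  by apply: (@filterE _ H); exact: hull_valP.
exists (exist _ a (mem_set ca)); split => // A U HA.
rewrite nbhsE => -[_ [[V oV <-]] /= Va VU].
have HA' : ((set_val : hull -> prod) @ H) [set set_val y | y in A].
  by apply: (@filterS _ H _ A) HA => y Ay; exists y.
have [_ [[y Ay <-] Vy]] := aH _ V HA' (open_nbhs_nbhs (conj oV Va)).
by exists y; split => //; exact: VU.
Qed.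

Lemma hull_hausdorff : hausdorff_space hull.
Proof.
move=> y z yz; apply: coordinate_inj => g; apply: (@Rhausdorff R) => U V yU zV.
have [w [Uw Vw]] :=
  yz _ _ (coordinate_continuous yU) (coordinate_continuous zV).
by exists (coordinate g w).
Qed.

Lemma hull_embed_continuous : continuous hull_embed.
Proof.
exact: (@continuous_comp_initial _ _ _ (set_val : hull -> prod) hull_embed
  evaluation_continuous).
Qed.

Lemma hull_embed_dense : dense (range hull_embed).
Proof.
move=> O [y Oy] [V oV VO]; rewrite -{}VO in Oy *.
have [_ [[x _ <-] Vx]] := hull_valP (open_nbhs_nbhs (conj oV Oy)).
by exists (hull_embed x); split => //; exists x.
Qed.

Lemma with_bumps_bump x e : G (bump x e).
Proof. by right; exists (x, e). Qed.

Definition bump_index (x : X) (e : R) : G :=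
  exist _ (bump x e) (mem_set (with_bumps_bump x e)).

Lemma coordinate_bump x e y :
  coordinate (bump_index x e) (hull_embed y) = bump x e y.
Proof. by []. Qed.

Lemma hull_embed_inj : injective hull_embed.
Proof.
move=> x y xy; apply: mdist_positivity; apply/eqP.
have : bump x 1 x = bump x 1 y by rewrite -!coordinate_bump xy.
rewrite /bump mdistxx subr0 (max_idPr ler01) => xy1.
have : 0 < Num.max 0 (1 - mdist x y) by rewrite -xy1.
rewrite lt_max ltxx /= => /ltW/max_idPr xy2.
by move: xy1; rewrite xy2; lra.
Qed.

(** Where the coordinate given by the bump of a ball is positive, a point of the
    hull is a limit of images of points of that ball.  The closed ball is
    compact by properness, so the limit is the image of a point of [X], and the
    positive bump places it in the ball. *)
Lemma hull_embed_open (U : set X) : open U -> open (hull_embed @` U).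
Proof.
move=> oU; rewrite openE => _ [x Ux <-].
have /nbhs_ballP[e /= e0 eU] : nbhs x U by exact: open_nbhs_nbhs.
pose b := coordinate (bump_index x e).
have b_pos y : 0 < b y -> nbhs y (b @^-1` [set t | 0 < t]).
  move=> by0; apply: coordinate_continuous; apply: open_nbhs_nbhs.
  by split=> //; exact: open_gt.
have bx : 0 < b (hull_embed x) by rewrite /b coordinate_bump bump_gt0 mdistxx.
have cK : closed (hull_embed @` closure (ball x e)).
  apply: compact_closed; first exact: hull_hausdorff.
  apply: continuous_compact; last exact/X_proper/metric_bounded_ball.
  exact/continuous_subspaceT/hull_embed_continuous.
apply: (@filterS _ _ _ (b @^-1` [set t | 0 < t])).
  move=> y /= by0; have [[z _ zy]|nKy] :=
      pselect ((hull_embed @` closure (ball x e)) y).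
    exists z => //; apply: eU; rewrite ballEmdist/= -bump_gt0.
    by move: by0; rewrite -zy /b coordinate_bump.
  have yK : nbhs y
      (~` (hull_embed @` closure (ball x e)) `&` b @^-1` [set t | 0 < t]).
    apply: filterI; last exact: b_pos.
    by apply: open_nbhs_nbhs; split=> //; exact: closed_openC.
  have [w [[nz bz] [z _ zE]]] := dense_nbhs hull_embed_dense yK.
  exfalso; apply: nz; rewrite -zE; exists z => //; apply: subset_closure.
  rewrite ballEmdist/= -bump_gt0.
  by move: bz; rewrite /= -zE /b coordinate_bump.
exact: b_pos.
Qed.

Lemma hull_compactification : compactification hull_embed.
Proof.
split.
- by split; [exact: hull_compact|exact: hull_hausdorff].
- exact: hull_embed_inj.
- exact: hull_embed_continuous.
- exact: hull_embed_open.
- exact: hull_embed_dense.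
Qed.

Lemma hull_extends f : G f -> extends hull_embed f.
Proof.
move=> Gf; pose g : G := exist _ f (mem_set Gf).
by exists (coordinate g) => //; exact: coordinate_continuous.
Qed.

(** The extensions to [Z] of the functions in the family are the coordinates of
    a continuous map to the product, and by density of [X] in [Z] it takes its
    values in the closure of the image of [X]. *)
Lemma hull_generated : generated_compactification F hull_embed.
Proof.
split; first exact: hull_compactification.
  by move=> f Ff; apply: hull_extends; left.
move=> Z j cj extj.
have extG f : G f -> extends j f.
  move=> [/extj//|[xe _ <-]].
  apply: (extends_bounded_support X_proper cj (K := ball xe.1 xe.2)).
  - exact: bump_continuous.
  - exact: metric_bounded_ball.
  - by move=> y; exact: bump_support.
have ext (g : G) : {h : Z -> R | continuous h & h \o j = set_val g}.
  by apply: cid2; exact: extG (set_valP g).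
pose h0 (z : Z) : prod := fun g => s2val (ext g) z.
have h0c : continuous h0.
  by apply: continuous_into_prod => g; exact: (s2valP (ext g)).
have h0j x : h0 (j x) = evaluation x.
  by apply/funext => g; exact: (congr1 (fun u => u x) (s2valP' (ext g))).
have h0_hull z : closure (range evaluation) (h0 z).
  move=> U /h0c zU; have [_ _ _ _ jd] := cj.
  have [w [Ux [x _ xE]]] := dense_nbhs jd zU.
  by exists (evaluation x); split; [exists x|rewrite -h0j xE].
pose h (z : Z) : hull := exist _ (h0 z) (mem_set (h0_hull z)).
exists h.
  exact: (@continuous_comp_initial _ _ _ (set_val : hull -> prod) h h0c).
by apply/funext => x; apply: val_inj; exact: h0j.
Qed.

(** By minimality on both sides, there are maps between [Y] and the hull under
    [X].  The composite on [Y] is the identity by density, so the map to the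
    hull is injective and pulls its coordinates back to functions separating
    the points of [Y]. *)
Lemma generated_separated {Y : topologicalType} (i : X -> Y) (p q : Y) :
  generated_compactification F i -> p <> q ->
  exists f g, [/\ G f, continuous g, g \o i = f & g p <> g q :> R].
Proof.
move=> [ci exti univ] pq.
have [Y_hausdorff Yd] : hausdorff_space Y /\ dense (range i).
  by have [[]] := ci.
have [h hc hi] := univ _ _ hull_compactification
  (fun f Ff => hull_extends (or_introl Ff)).
have [_ _ /(_ _ _ ci exti)[k kc ki]] := hull_generated.
have hk y : h (k y) = y.
  apply/esym/Y_hausdorff => U V yU yV.
  have hkV : nbhs y ((h \o k) @^-1` V).
    exact: (@continuous_comp _ _ _ k h y (kc y) (hc (k y)) V yV).
  have [w [[Ux Vx] [x _ xE]]] := dense_nbhs Yd (filterI yU hkV).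
  exists (i x); rewrite xE; split => //; move: Vx.
  by rewrite /= -xE -[k (i x)]/((k \o i) x) ki -[h _]/((h \o hull_embed) x) hi.
have [g gpq] : exists g, coordinate g (k p) <> coordinate g (k q).
  apply: contrapT => /forallNP gpq; apply: pq; rewrite -(hk p) -(hk q).
  by congr h; apply: coordinate_inj => g; exact: contrapT.
exists (set_val g), (coordinate g \o k); split => //.
- exact: set_valP.
- by move=> y; apply: continuous_comp; [exact: kc|exact: coordinate_continuous].
- by rewrite -compA ki.
Qed.

End GeneratedCompactification.

Theorem theoremA (R : realType) (X : metricType R) (X_proper : proper_metric X) :
  (forall (Y : topologicalType) (i : X -> Y), compactification i ->
     (coarse_compactification i <-> large_scale_proximity (boundary_rel i)) /\
     (large_scale_proximity (boundary_rel i) <->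
        forall f : X -> R, extendable i f -> higson f)) /\
  (forall r : set X -> set X -> Prop, large_scale_proximity r ->
     forall S : set X, delone S ->
       compactification (@prox_embed R X r S) /\
       coarse_compactification (@prox_embed R X r S)) /\
  (forall F : set (X -> R), function_algebra F ->
     (forall f, F f -> higson f) ->
     (exists (Y : topologicalType) (i : X -> Y),
        generated_compactification F i) /\
     (forall (Y : topologicalType) (i : X -> Y),
        generated_compactification F i -> coarse_compactification i)).
Proof.
split=> [Y i ci|].
  have proximity f : large_scale_proximity (boundary_rel i) ->
    extendable i f -> higson f by exact: proximity_higson.
  split; split.
  - exact: coarse_proximity.
  - by move=> ir; apply: higson_coarse => // f; exact: proximity.
  - by move=> ir f; exact: proximity.
  - by move=> fh; apply: coarse_proximity => //; exact: higson_coarse.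
split=> [r lr S dS|F _ Fh].
  by split; [exact: prox_compactification|exact: prox_coarse].
have F_bounded f : F f -> bounded_fun f by case/Fh.
have F_continuous f : F f -> continuous f by case/Fh.
split; first by exists (hull F), (@hull_embed _ _ F); exact: hull_generated.
move=> Y i Yi; have [ci _ _] := Yi.
apply: separation_coarse => // p q pq.
have [f [g [Gf gc gf gpq]]] :=
  generated_separated X_proper F_bounded F_continuous Yi pq.
exists f, g; split=> //.
by case: Gf => [/Fh//|[xe _ <-]]; exact: higson_bump.
Qed.
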